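(* Let $A$ and $B$ be two vector spaces and let $\mu: A\times A\to A$ $((a,b)\mapsto a\cdot_A b)$, $\nu:B\times B\to B$ $((x,y)\mapsto x\cdot_B y)$, $\vartriangleright: A\times B\to B$, $\vartriangleleft: B\times A\to B$, $\rightharpoonup: B\times A\to A$, $\leftharpoonup: A\times B\to A$, $\theta: A\times A\to B$ be bilinear maps. Define bilinear maps on $A\oplus B$ by $$\widetilde\theta((a,x),(b,y))=(0,\theta(a,b)),\quad \mu_{\vartriangleright,\vartriangleleft}((a,x),(b,y))=(a\cdot_A b,\ a\vartriangleright y+x\vartriangleleft b),\quad \nu_{\rightharpoonup,\leftharpoonup}((a,x),(b,y))=(a\leftharpoonup y+x\rightharpoonup b,\ x\cdot_B y).$$ Then the tuple $(A_\mu,B_\nu,\vartriangleright,\vartriangleleft,\rightharpoonup,\leftharpoonup,\theta)$ is a quasi-twilled associative algebra if and only if the element $\Omega=\widetilde\theta+\mu_{\vartriangleright,\vartriangleleft}+\nu_{\rightharpoonup,\leftharpoonup}\in\mathscr Q_1$ is a Maurer-Cartan element of the graded Lie algebra $\mathscr Q=(\bigoplus_{n\ge 0}\mathscr Q_n,[\ ,\ ])$, i.e. $[\Omega,\Omega]=0$.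
   Context: A quasi-twilled associative algebra is an associative algebra whose underlying vector space has a direct sum decomposition $A\oplus B$ such that $B$ is a subalgebra. The tuple $(A_\mu,B_\nu,\vartriangleright,\vartriangleleft,\rightharpoonup,\leftharpoonup,\theta)$ is called a quasi-twilled associative algebra if the multiplication $(a,x)\cdot(b,y)=(a\cdot_A b+a\leftharpoonup y+x\rightharpoonup b,\ x\cdot_B y+a\vartriangleright y+x\vartriangleleft b+\theta(a,b))$ on $A\oplus B$ is associative. Let $\mathfrak g=\bigoplus_{n\ge0}\mathfrak g_n$, $\mathfrak g_n=\mathrm{Hom}((A\oplus B)^{\otimes n+1},A\oplus B)$, with the Gerstenhaber bracket: for $f$ with $m$ inputs and $g$ with $n$ inputs, $[f,g]=f\diamond g-(-1)^{(m-1)(n-1)}g\diamond f$, where $(f\diamond g)(v_1,\ldots,v_{m+n-1})=\sum_{i=1}^m(-1)^{(i-1)(n-1)}f(v_1,\ldots,v_{i-1},g(v_i,\ldots,v_{i+n-1}),v_{i+n},\ldots,v_{m+n-1})$. This is a graded Lie algebra. Let $\mathcal A^{k,l}$ be the direct sum of all $(k+l)$-fold tensor products of $A$'s and $B$'s in which $A$ appears $k$ times and $B$ appears $l$ times, so $(A\oplus B)^{\otimes n+1}\cong\bigoplus_{k+l=n+1}\mathcal A^{k,l}$. For $k,l\ge -1$ with $k+l=n$, $C^{k|l}\subset\mathfrak g_n$ is the space of maps $f$ with $f(\mathcal A^{k+1,l})\subset A$, $f(\mathcal A^{k,l+1})\subset B$ and $f=0$ on all other components. Put $\mathscr Q_n=C^{n+1|-1}\oplus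 C^{n|0}\oplus C^{n-1|1}\oplus\cdots\oplus C^{0|n}\subset\mathfrak g_n$; $\mathscr Q=\bigoplus_{n\ge0}\mathscr Q_n$ is a graded Lie subalgebra of $\mathfrak g$.
   Formalization: The ground field is assumed to have characteristic different from 2; in characteristic 2 one has [Ω,Ω] = 2(Ω⋄Ω) = 0 for every Ω, so the stated equivalence fails for any non-associative multiplication. *)

(* Defs.v *)
From HB Require Import structures.
From mathcomp Require Import all_boot all_order all_algebra.
From mathcomp Require Import boolp functions.

Set Implicit Arguments.
Unset Strict Implicit.
Unset Printing Implicit Defensive.

Import GRing.Theory.
Local Open Scope ring_scope.

Section Cochains.
Variables (K : fieldType) (V : lmodType K).

Definition multilinear m (f : ('I_m -> V) -> V) : Prop :=
  forall (s : 'I_m) (c : K) (x y : V) (v : 'I_m -> V),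
    f [eta v with s |-> c *: x + y] =
    c *: f [eta v with s |-> x] + f [eta v with s |-> y].

Definition multilinear_pred m : {pred ('I_m -> V) -> V} :=
  fun f => `[< multilinear f >].

Lemma multilinear_submod_closed m : submod_closed (@multilinear_pred m).
Proof.
split; first by apply/asboolP => s c x y v; rewrite /= scaler0 addr0.
move=> a f g /asboolP hf /asboolP hg; apply/asboolP => s c x y v.
have E u : (a *: f + g) u = a *: f u + g u by [].
by rewrite !E hf hg !scalerDr !scalerA (mulrC a) addrACA.
Qed.

HB.instance Definition _ m :=
  GRing.isSubmodClosed.Build K (('I_m -> V) -> V) (@multilinear_pred m)
    (multilinear_submod_closed m).

(* Hom(V^{(x) (n+1)}, V), as the space of (n+1)-multilinear maps. *)
Record cochain n := Cochain {
  cochain_fun :> ('I_n.+1 -> V) -> V;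
  _ : cochain_fun \in @multilinear_pred n.+1 }.

HB.instance Definition _ n := [isSub for @cochain_fun n].
HB.instance Definition _ n := [Choice of cochain n by <:].
HB.instance Definition _ n := [SubChoice_isSubLmodule of cochain n by <:].

Lemma cochainP n (f : cochain n) : multilinear f.
Proof. by case: f => f /= /asboolP. Qed.

Definition mk_cochain n f (hf : multilinear f) : cochain n :=
  Cochain (introT (asboolP _) hf).

Lemma bilinear_multilinear (T : {bilinear V -> V -> V}) :
  multilinear (fun v : 'I_2 -> V => T (v ord0) (v ord_max)).
Proof.
move=> s c x y v /=; have [->|->] : s = ord0 \/ s = ord_max.
- by case: s => -[|[|//]] ?; [left|right]; apply: val_inj.
- by rewrite /= linearPl.
- by rewrite /= linearPr.
Qed.

Definition cochain_of_bilinear (T : {bilinear V -> V -> V}) : cochain 1 :=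
  mk_cochain (bilinear_multilinear T).

(* For i = 0..p, with 0-based arguments, the arguments of the outer map in
     f (v_0, ..., v_(i-1), g (v_i, ..., v_(i+q)), v_(i+q+1), ..., v_(p+q)).
   Every index passed to inord is at most p + q, hence never truncated. *)
Definition insert_args p q (g : ('I_q.+1 -> V) -> V) (i : 'I_p.+1)
    (v : 'I_(p + q).+1 -> V) : 'I_p.+1 -> V :=
  fun j => if (j < i)%N then v (inord j)
           else if j == i then g (fun k => v (inord (i + k)))
           else v (inord (j + q)).

Lemma insert_multilinear p q (f : cochain p) (g : cochain q) (i : 'I_p.+1) :
  multilinear (fun v => f (insert_args g i v)).
Proof.
have ip : (i <= p)%N by rewrite -ltnS.
move=> s c x y v; have sp : (s <= p + q)%N by rewrite -ltnS.
have E z k : (k <= p + q)%N ->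
    (if inord k == s then z else v (inord k)) =
    if k == s then z else v (inord k).
  by move=> hk; rewrite -val_eqE /= inordK.
have jq (j : 'I_p.+1) : (j + q <= p + q)%N by rewrite leq_add2r -ltnS.
have jp (j : 'I_p.+1) : (j <= p + q)%N.
  by rewrite (leq_trans _ (leq_addr _ _)) // -ltnS.
have kq (k : 'I_q.+1) : (i + k <= p + q)%N by rewrite leq_add // -ltnS.
have [si|le_is] := ltnP s i.
  have sp' : (s < p.+1)%N by exact: leq_trans si (leqW ip).
  have H z : insert_args g i [eta v with s |-> z] =
      [eta insert_args g i v with inord s |-> z].
    apply: funext => j; rewrite /insert_args /= -[j == inord _]val_eqE /= (inordK sp').
    case: ltnP => ji; first by rewrite E.
    rewrite (gtn_eqF (leq_trans si ji)); case: eqP => _; last first.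
      by rewrite E // gtn_eqF // (leq_trans (leq_trans si ji)) ?leq_addr.
    congr (cochain_fun g _); apply: funext => k; rewrite /= E // gtn_eqF //.
    by rewrite (leq_trans si) ?leq_addr.
  by rewrite !H cochainP.
have [siq|iqs] := leqP s (i + q).
  have sq : (s - i < q.+1)%N by rewrite ltnS leq_subLR.
  have H z : insert_args g i [eta v with s |-> z] =
      [eta insert_args g i v with i |->
         g [eta (fun k => v (inord (i + k))) with inord (s - i) |-> z]].
    apply: funext => j; rewrite /insert_args /=.
    have [ji|ij] := ltnP j i.
      by rewrite E // (ltn_eqF (leq_trans ji le_is)) -val_eqE /= (ltn_eqF ji).
    have [_|nij] := eqVneq j i.
      congr (cochain_fun g _); apply: funext => k /=.
      rewrite E // -[k == _]val_eqE /= inordK //.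
      by rewrite -(eqn_add2l i k) subnKC.
    rewrite E // gtn_eqF // (leq_ltn_trans siq) // ltn_add2r ltn_neqAle ij.
    by rewrite andbT eq_sym.
  by rewrite !H cochainP cochainP.
have qs : (q <= s)%N by rewrite (leq_trans _ (ltnW iqs)) ?leq_addl.
have sp' : (s - q < p.+1)%N by rewrite ltnS leq_subLR (addnC q).
have iqs' : (i < s - q)%N by rewrite ltn_subRL (addnC q).
have H z : insert_args g i [eta v with s |-> z] =
    [eta insert_args g i v with inord (s - q) |-> z].
  apply: funext => j; rewrite /insert_args /= -[j == inord _]val_eqE /=.
  rewrite inordK //; have [ji|ij] := ltnP j i.
    rewrite E // (ltn_eqF (ltn_trans ji iqs')) ltn_eqF //.
    by rewrite (leq_trans ji).
  have [->|nij] := eqVneq j i.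
    rewrite (ltn_eqF iqs'); congr (cochain_fun g _); apply: funext => k /=.
    rewrite E // ltn_eqF // (leq_ltn_trans _ iqs) // leq_add2l -ltnS.
    exact: ltn_ord.
  by rewrite E // -(eqn_add2r q j) subnK.
by rewrite !H cochainP.
Qed.

Definition insert_at p q (f : cochain p) (g : cochain q) (i : 'I_p.+1) :
  cochain (p + q) := mk_cochain (insert_multilinear f g i).

Definition circ p q (f : cochain p) (g : cochain q) : cochain (p + q) :=
  \sum_(i < p.+1) (-1) ^+ (i * q) *: insert_at f g i.

Definition gerstenhaber p q (f : cochain p) (g : cochain q) : cochain (p + q) :=
  circ f g - (-1) ^+ (p * q) *: ecast n (cochain n) (addnC q p) (circ g f).

(* Degree-one solutions of [x, x] = 0 in a graded subspace L (zero
   differential). *)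
Definition maurer_cartan (L : forall n, cochain n -> Prop) (x : cochain 1) :=
  L 1 x /\ gerstenhaber x x = 0.

End Cochains.

Section QuasiTwilled.
Variables (K : fieldType) (A B : lmodType K).

(* v is a family of homogeneous arguments: in A at the positions in S, in B
   elsewhere. Such elementary tensors span the summand of the tensor power
   attached to S. *)
Definition homogeneous m (S : {set 'I_m}) (v : 'I_m -> A * B) : Prop :=
  forall i, if i \in S then (v i).2 = 0 else (v i).1 = 0.

(* C^{k|l}, for k, l >= -1 with k + l = n. *)
Definition bidegree n (k l : int) (f : cochain (A * B)%type n) : Prop :=
  forall (S : {set 'I_n.+1}) (v : 'I_n.+1 -> A * B), homogeneous S v ->
    let inA := #|S|%:Z = k + 1 /\ #|~: S|%:Z = l in
    let inB := #|S|%:Z = k /\ #|~: S|%:Z = l + 1 in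
    [/\ inA -> (f v).2 = 0, inB -> (f v).1 = 0 & ~ inA -> ~ inB -> f v = 0].

(* C^{n+1|-1} + C^{n|0} + ... + C^{0|n}; C^{-1|n+1} is left out. *)
Definition Qspace n (f : cochain (A * B)%type n) : Prop :=
  exists F : 'I_n.+2 -> cochain (A * B)%type n,
    (forall i : 'I_n.+2, bidegree (n.+1%:Z - i%:Z) (i%:Z - 1) (F i))
    /\ f = \sum_i F i.

(* a tr y, x tl a, x hr a, a hl y are the right/left triangle actions on B and
   the right/left harpoon actions on A. *)
Variables (mu : {bilinear A -> A -> A}) (nu : {bilinear B -> B -> B})
  (tr : {bilinear A -> B -> B}) (tl : {bilinear B -> A -> B})
  (hr : {bilinear B -> A -> A}) (hl : {bilinear A -> B -> A})
  (theta : {bilinear A -> A -> B}).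

Definition qt_mul (u v : A * B) : A * B :=
  (mu u.1 v.1 + hl u.1 v.2 + hr u.2 v.1,
   nu u.2 v.2 + tr u.1 v.2 + tl u.2 v.1 + theta u.1 v.1).

Definition quasi_twilled : Prop := associative qt_mul.

Definition theta_lift (u v : A * B) : A * B := (0, theta u.1 v.1).

Definition mu_lift (u v : A * B) : A * B :=
  (mu u.1 v.1, tr u.1 v.2 + tl u.2 v.1).

Definition nu_lift (u v : A * B) : A * B :=
  (hl u.1 v.2 + hr u.2 v.1, nu u.2 v.2).

Lemma theta_lift_bilinear : bilinear_for *:%R *:%R theta_lift.
Proof.
by split=> w c x y; congr pair => /=;
  rewrite ?(linearPl, linearPr) ?scaler0 ?addr0.
Qed.

Lemma mu_lift_bilinear : bilinear_for *:%R *:%R mu_lift.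
Proof.
by split=> w c x y; congr pair => /=;
  rewrite ?(linearPl, linearPr) // scalerDr addrACA.
Qed.

Lemma nu_lift_bilinear : bilinear_for *:%R *:%R nu_lift.
Proof.
by split=> w c x y; congr pair => /=;
  rewrite ?(linearPl, linearPr) // scalerDr addrACA.
Qed.

HB.instance Definition _ := bilinear_isBilinear.Build K
  (A * B)%type (A * B)%type (A * B)%type _ _ theta_lift theta_lift_bilinear.
HB.instance Definition _ := bilinear_isBilinear.Build K
  (A * B)%type (A * B)%type (A * B)%type _ _ mu_lift mu_lift_bilinear.
HB.instance Definition _ := bilinear_isBilinear.Build K
  (A * B)%type (A * B)%type (A * B)%type _ _ nu_lift nu_lift_bilinear.

Definition Omega : cochain (A * B)%type 1 :=
  cochain_of_bilinear theta_lift + cochain_of_bilinear mu_lift +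
  cochain_of_bilinear nu_lift.

End QuasiTwilled.

(* Main.v *)
Require Import Defs.
From mathcomp Require Import all_boot all_order all_algebra.
From mathcomp Require Import boolp.
Local Open Scope ring_scope.

(** A cochain [f] of degree one on [V] is a bilinear product on [V].
    As the degree is odd, the two terms of the bracket add up, and
    [[f, f] = 2 (f <> f)] ([gerstenhaber_odd]).  The composition [f <> f] has
    two insertions with opposite signs, so its value at [(x, y, z)] is the
    associator [(x y) z - x (y z)] ([circ1E]).  Since 2 is invertible,
    [[f, f] = 0] exactly when the product is associative
    ([gerstenhaber_eq0_associative]).  For [Omega] this product is the
    multiplication of the tuple on [A + B] ([Omega_product]).

    For the membership in [Q_1], the three summands of [Omega] are homogeneous
    of bidegrees [2|-1], [1|0] and [0|1]: a bilinear product on [A + B] is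
    tested on two arguments, each lying in [A] or in [B]. *)

Set Implicit Arguments.
Unset Strict Implicit.
Unset Printing Implicit Defensive.

Import GRing.Theory.

Section DegreeOne.
Variables (K : fieldType) (V : lmodType K).

Lemma cochain_eq n (f g : cochain V n) : (forall v, f v = g v) -> f = g.
Proof. by move=> fg; apply/val_inj/funext. Qed.

Lemma gerstenhaber_odd p (f : cochain V p) :
  odd p -> gerstenhaber f f = 2%:R *: circ f f.
Proof.
move=> p_odd.
(* The cast is along an equation [p + p = p + p], hence trivial. *)
rewrite /gerstenhaber (eq_axiomK (addnC p p)) /=.
by rewrite -signr_odd oddM p_odd expr1 scaleN1r opprK scaler_nat mulr2n.
Qed.

(** The product on [V] given by a cochain of degree one. *)
Definition product_of_cochain (f : cochain V 1) (x y : V) : V :=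
  f (fun i : 'I_2 => if i == ord0 then x else y).

Lemma product_of_cochainE (f : cochain V 1) (v : 'I_2 -> V) :
  f v = product_of_cochain f (v ord0) (v ord_max).
Proof.
rewrite /product_of_cochain; congr (cochain_fun f _); apply: funext.
by case=> -[|[|//]] i_lt; congr v; apply: val_inj.
Qed.

Lemma circ1E (f : cochain V 1) (v : 'I_3 -> V) :
  let op := product_of_cochain f in
  circ f f v = op (op (v (inord 0)) (v (inord 1))) (v (inord 2))
             - op (v (inord 0)) (op (v (inord 1)) (v (inord 2))).
Proof.
move=> op; rewrite /circ big_ord_recl big_ord1 !muln1 expr0 expr1.
rewrite scale1r scaleN1r.
have -> (g h : cochain V (1 + 1)) : (g - h) v = g v - h v by [].
rewrite /= !product_of_cochainE /insert_args /=.
by rewrite !product_of_cochainE /= ?addn0.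
Qed.

Lemma gerstenhaber_eq0_associative (f : cochain V 1) : 2%:R != 0 :> K ->
  gerstenhaber f f = 0 <-> associative (product_of_cochain f).
Proof.
move=> two_neq0; rewrite gerstenhaber_odd //; split=> [/eqP|f_assoc].
  rewrite scaler_eq0 (negPf two_neq0) => /eqP circ0 x y z.
  have := circ1E f (fun i => nth 0 [:: x; y; z] i).
  rewrite circ0 !inordK //= => /esym/eqP.
  by rewrite subr_eq0 => /eqP.
suff -> : circ f f = 0 by rewrite scaler0.
by apply: cochain_eq => v; rewrite circ1E f_assoc subrr.
Qed.

End DegreeOne.

Section QuasiTwilledProduct.
Variables (K : fieldType) (A B : lmodType K).

(** Here [n] counts the arguments lying in [A], so that [2 - n] lie in [B]; the
    four alternatives are the summands [A * A], [A * B], [B * A] and [B * B] of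
    the tensor square. *)
Lemma bidegree_bilinear (T : {bilinear (A * B)%type -> (A * B)%type ->
    (A * B)%type}) (k l : int) :
  (forall n (u v : A * B),
    [\/ [/\ n = 2%N, u.2 = 0 & v.2 = 0],
        [/\ n = 1%N, u.2 = 0 & v.1 = 0],
        [/\ n = 1%N, u.1 = 0 & v.2 = 0] |
        [/\ n = 0%N, u.1 = 0 & v.1 = 0]] ->
    let inA := n%:Z = k + 1 /\ (2 - n)%N%:Z = l in
    let inB := n%:Z = k /\ (2 - n)%N%:Z = l + 1 in
    [/\ inA -> (T u v).2 = 0, inB -> (T u v).1 = 0
      & ~ inA -> ~ inB -> T u v = 0]) ->
  bidegree k l (cochain_of_bilinear T).
Proof.
move=> T_deg S v v_hom.
have -> : #|~: S| = (2 - #|S|)%N by rewrite cardsCs setCK card_ord.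
apply: T_deg; have := v_hom ord0; have := v_hom ord_max.
have -> : #|S| = ((ord0 \in S) + (ord_max \in S))%N.
  rewrite -sum1_card big_mkcond big_ord_recl big_ord1 /=.
  have -> : lift ord0 ord0 = ord_max :> 'I_2 by apply: val_inj.
  by case: (ord0 \in S); case: (ord_max \in S).
case: (ord0 \in S) => /=; case: (ord_max \in S) => v1 v0.
- by constructor 1.
- by constructor 2.
- by constructor 3.
- by constructor 4.
Qed.

Variables (mu : {bilinear A -> A -> A}) (nu : {bilinear B -> B -> B})
  (tr : {bilinear A -> B -> B}) (tl : {bilinear B -> A -> B})
  (hr : {bilinear B -> A -> A}) (hl : {bilinear A -> B -> A})
  (theta : {bilinear A -> A -> B}).

Lemma theta_lift_bidegree :
  bidegree 2 (-1) (cochain_of_bilinear (theta_lift theta)).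
Proof.
apply: bidegree_bilinear => n [a x] [b y] /=.
rewrite /theta_lift /= => -[] [-> u0 v0]; split=> //=.
(* Indices that do not match the component, then the component excluded by
   the negative hypotheses, then the vanishing of the remaining values. *)
all: try by case.
all: try by move=> _ /(_ (conj erefl erefl)).
all: by rewrite ?u0 ?v0 ?linear0l ?linear0r.
Qed.

Lemma mu_lift_bidegree :
  bidegree 1 0 (cochain_of_bilinear (mu_lift mu tr tl)).
Proof.
apply: bidegree_bilinear => n [a x] [b y] /=.
rewrite /mu_lift /= => -[] [-> u0 v0]; split=> //=.
(* Indices that do not match the component, then the component excluded by
   the negative hypotheses, then the vanishing of the remaining values. *)
all: try by case.
all: try by move=> _ /(_ (conj erefl erefl)).
all: try by move=> /(_ (conj erefl erefl)).
all: by rewrite ?u0 ?v0 ?linear0l ?linear0r ?addr0.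
Qed.

Lemma nu_lift_bidegree :
  bidegree 0 1 (cochain_of_bilinear (nu_lift nu hr hl)).
Proof.
apply: bidegree_bilinear => n [a x] [b y] /=.
rewrite /nu_lift /= => -[] [-> u0 v0]; split=> //=.
(* Indices that do not match the component, then the component excluded by
   the negative hypotheses, then the vanishing of the remaining values. *)
all: try by case.
all: try by move=> _ /(_ (conj erefl erefl)).
all: try by move=> /(_ (conj erefl erefl)).
all: by rewrite ?u0 ?v0 ?linear0l ?linear0r ?addr0.
Qed.

Lemma Omega_Qspace : Qspace (Omega mu nu tr tl hr hl theta).
Proof.
exists (tnth [tuple cochain_of_bilinear (theta_lift theta);
                    cochain_of_bilinear (mu_lift mu tr tl);
                    cochain_of_bilinear (nu_lift nu hr hl)]); split.
  case=> -[|[|[|//]]] i_lt.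
  - exact: theta_lift_bidegree.
  - exact: mu_lift_bidegree.
  - exact: nu_lift_bidegree.
by rewrite !big_ord_recl big_ord0 addr0 addrA.
Qed.

Lemma Omega_product : product_of_cochain (Omega mu nu tr tl hr hl theta) =
  qt_mul mu nu tr tl hr hl theta.
Proof.
apply: funext => -[a x]; apply: funext => -[b y].
have -> : product_of_cochain (Omega mu nu tr tl hr hl theta) (a, x) (b, y) =
  theta_lift theta (a, x) (b, y) + mu_lift mu tr tl (a, x) (b, y)
  + nu_lift nu hr hl (a, x) (b, y) by [].
congr pair => /=; first by rewrite add0r addrA.
by rewrite addrC -[theta _ _ + _]addrC !addrA.
Qed.

End QuasiTwilledProduct.

Theorem theorem3p14 (K : fieldType) (char_neq2 : 2%:R != 0 :> K)
  (A B : lmodType K)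
  (mu : {bilinear A -> A -> A}) (nu : {bilinear B -> B -> B})
  (tr : {bilinear A -> B -> B}) (tl : {bilinear B -> A -> B})
  (hr : {bilinear B -> A -> A}) (hl : {bilinear A -> B -> A})
  (theta : {bilinear A -> A -> B}) :
  Qspace (Omega mu nu tr tl hr hl theta) /\
  (quasi_twilled mu nu tr tl hr hl theta <->
   maurer_cartan (@Qspace K A B) (Omega mu nu tr tl hr hl theta)).
Proof.
have OmegaQ := Omega_Qspace mu nu tr tl hr hl theta.
have := gerstenhaber_eq0_associative (Omega mu nu tr tl hr hl theta) char_neq2.
rewrite Omega_product => Omega_assoc.
by split=> //; split=> [/Omega_assoc|[_ /Omega_assoc]].
Qed.
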